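(* Let $r\geq5$ be odd and let $\varnothing\neq I=\{i_1<\cdots<i_k\}\subseteq\{1,\ldots,r-1\}$. The only arrows in the oriented graph $\Gamma_{c_I}$ are those given by $$A(a,b)\longrightarrow B(q)\iff b\leq q,$$ where $a\in I$, $a<b<n_I(a)$ and $i_1<q\leq r$. Consequently $$\nu_1(c_I)=A_I,\qquad \nu_m(c_I)=\varnothing\quad(m\geq2).$$ The same statement for $d_I$ is obtained by applying $\tau$: the only arrows in $\Gamma_{d_I}$ are those given by $\tau(A(a,b))\to\tau(B(q))\iff b\leq q$ (with the same ranges of $a,b,q$), and $\nu_1(d_I)=\tau(A_I)$, $\nu_m(d_I)=\varnothing$ for $m\geq2$.
   Context: Root system and group. Let $e_1,\ldots,e_r$ be the standard orthonormal basis of $\mathbb R^r$. $W(D_r)$ is the group of linear maps $u$ with $u(e_j)=\varepsilon_j e_{\pi(j)}$, $\pi\in S_r$, $\varepsilon_j\in\{\pm1\}$, with an even number of negative signs. Positive roots: $\Pi_+=\{e_i-e_j,\ e_i+e_j:1\leq i<j\leq r\}$. Simple roots: $\alpha_i=e_i-e_{i+1}$ ($1\leq i\leq r-1$), $\alpha_r=e_{r-1}+e_r$. Root order: $\rho\leq\eta$ iff $\eta-\rho\in\sum_{a=1}^r\mathbb Z_{\geq0}\alpha_a$. $\tau$ is the linear map with $\tau(e_j)=e_j$ ($1\leq j\leq r-1$), $\tau(e_r)=-e_r$. Graph and sequence. For $S\subseteq\Pi_+$ let $\operatorname{Adj}(S)=\{\gamma\in\Pi_+:\gamma\leq\beta\text{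 for some }\beta\in S\}$. For $u\in W(D_r)$ let $\nu_0(u)=u(\Pi_+)\cap\Pi_+$ and $\nu_k(u)=u(\operatorname{Adj}(\nu_{k-1}(u)))\cap\Pi_+$ for $k\geq1$. The oriented graph $\Gamma_u$ has vertex set $\nu_0(u)$ and an arrow $\alpha\to\beta$ iff $u^{-1}(\alpha)\leq\beta$. Signed cyclic elements. For $I$ as in the claim, $p_I\in S_r$ is given by $p_I(i_a)=i_{a+1}$ ($1\leq a<k$), $p_I(i_k)=r$, $p_I(r)=i_1$, $p_I(j)=j$ for $j\notin I\cup\{r\}$. Then $c_I,d_I\in W(D_r)$ are given by $c_I(e_j)=-e_{p_I(j)}$ ($1\leq j\leq r-1$), $c_I(e_r)=e_{i_1}$; and $d_I(e_j)=-e_{p_I(j)}$ ($j\in\{1,\ldots,r-1\}\setminus\{i_k\}$), $d_I(e_{i_k})=e_r$, $d_I(e_r)=-e_{i_1}$. One has $d_I=\tau c_I\tau^{-1}$. For $a\in I$, $n_I(a)$ is the next element of $I\cup\{r\}$ after $a$. Put $A(a,b)=e_b-e_{n_I(a)}$ for $a\in I$, $a<b<n_I(a)$, and $B(q)=e_{i_1}-e_q$ for $i_1<q\leq r$; $A_I$ is the set of all $A(a,b)$ and $B_I$ the set of all $B(q)$. The vertex set $\nu_0(c_I)$ equals $A_I\sqcup B_I$. *)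

(* Defs.v *)
From HB Require Import structures.
From mathcomp Require Import all_boot all_order fingroup perm all_algebra.
From mathcomp Require Import boolp classical_sets reals.

Set Implicit Arguments.
Unset Strict Implicit.
Unset Printing Implicit Defensive.

Import Order.TTheory GRing.Theory Num.Theory.

Local Open Scope classical_set_scope.
Local Open Scope ring_scope.

(** Vectors are columns and a linear map [u] acts by [u *m x].  All indices are
    1-based natural numbers: [e R r j] is the [j]-th standard basis vector for
    [1 <= j <= r] (and [0] for other [j]). *)

Definition e (R : realType) (r j : nat) : 'cV[R]_r :=
  \col_(i < r) ((i : nat).+1 == j)%:R.

(** The linear map sending [e R r j] to [f j] for [1 <= j <= r]
    (see [linmapE]). *)
Definition linmap (R : realType) (r : nat) (f : nat -> 'cV[R]_r) : 'M[R]_r :=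
  \matrix_(i < r, j < r) f (j : nat).+1 i 0.

Definition WD (R : realType) (r : nat) : set 'M[R]_r :=
  [set u | exists (s : 'S_r) (neg : {set 'I_r}), ~~ odd #|neg| /\
     forall j : 'I_r,
       u *m e R r j.+1 = (-1) ^+ (j \in neg) *: e R r (s j).+1].
Arguments WD : clear implicits.

Definition pos_roots (R : realType) (r : nat) : set 'cV[R]_r :=
  [set x | exists i j : nat, [/\ (1 <= i)%N, (i < j)%N, (j <= r)%N &
     x = e R r i - e R r j \/ x = e R r i + e R r j]].
Arguments pos_roots : clear implicits.

Definition simple_root (R : realType) (r i : nat) : 'cV[R]_r :=
  if (i < r)%N then e R r i - e R r i.+1 else e R r r.-1 + e R r r.

Definition root_le (R : realType) (r : nat) (rho eta : 'cV[R]_r) : Prop :=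
  exists m : nat -> nat,
    eta - rho = \sum_(1 <= a < r.+1) simple_root R r a *+ m a.

Definition Adj (R : realType) (r : nat) (S : set 'cV[R]_r) : set 'cV[R]_r :=
  [set g | pos_roots R r g /\ exists2 b, S b & root_le g b].

Fixpoint nu (R : realType) (r : nat) (u : 'M[R]_r) (k : nat) : set 'cV[R]_r :=
  match k with
  | 0%N => [set u *m x | x in pos_roots R r] `&` pos_roots R r
  | k'.+1 => [set u *m x | x in Adj (nu u k')] `&` pos_roots R r
  end.

Record digraph (V : Type) := Digraph {
  vertex : set V;
  arrow : V -> V -> Prop }.

Definition Gamma (R : realType) (r : nat) (u : 'M[R]_r) : digraph 'cV[R]_r :=
  {| vertex := nu u 0;
     arrow := fun alpha beta =>
       [/\ nu u 0 alpha, nu u 0 beta & root_le (invmx u *m alpha) beta] |}.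

Definition tau (R : realType) (r : nat) : 'M[R]_r :=
  linmap (fun j => if j == r then - e R r r else e R r j).

(** The set [I = {i_1 < ... < i_k}] is given by its increasing enumeration, a
    sequence [s]; thus [i_1 = head 0 s] and [i_k = last 0 s]. *)

Definition increasing_subset (r : nat) (s : seq nat) : bool :=
  sorted ltn s && all (fun i => (1 <= i < r)%N) s.

(** The cycle [i_1 -> ... -> i_k -> r -> i_1]; [next c x = x] if [x] is not
    in [c]. *)
Definition p_I (r : nat) (s : seq nat) (j : nat) : nat := next (rcons s r) j.

Definition n_I (r : nat) (s : seq nat) (a : nat) : nat :=
  head r [seq x <- s | (a < x)%N].

Definition c_I (R : realType) (r : nat) (s : seq nat) : 'M[R]_r :=
  linmap (fun j => if j == r then e R r (head 0%N s)
                   else - e R r (p_I r s j)).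

Definition d_I (R : realType) (r : nat) (s : seq nat) : 'M[R]_r :=
  linmap (fun j => if j == r then - e R r (head 0%N s)
                   else if j == last 0%N s then e R r r
                   else - e R r (p_I r s j)).

Definition rootA (R : realType) (r : nat) (s : seq nat) (a b : nat) : 'cV[R]_r :=
  e R r b - e R r (n_I r s a).

Definition rootB (R : realType) (r : nat) (s : seq nat) (q : nat) : 'cV[R]_r :=
  e R r (head 0%N s) - e R r q.

Definition rangeA (r : nat) (s : seq nat) (a b : nat) : bool :=
  (a \in s) && (a < b < n_I r s a)%N.

Definition rangeB (r : nat) (s : seq nat) (q : nat) : bool :=
  (head 0%N s < q <= r)%N.

Definition A_I (R : realType) (r : nat) (s : seq nat) : set 'cV[R]_r :=
  [set x | exists a b : nat, rangeA r s a b /\ x = rootA R r s a b].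
Arguments A_I : clear implicits.

(** The remaining facts check that [c_I] and [d_I] are the intended elements
    of [WD]. *)

Lemma linmapE (R : realType) (r : nat) (f : nat -> 'cV[R]_r) (j : nat) :
  (1 <= j <= r)%N -> linmap f *m e R r j = f j.
Proof.
case: j => [//|j] /= ltjr; apply/colP => i; rewrite !mxE.
rewrite (bigD1 (Ordinal ltjr)) //= !mxE eqxx mulr1 big1 ?addr0 // => k nkj.
rewrite !mxE eqSS; case: eqP => [kj|]; last by rewrite mulr0.
by case/eqP: nkj; apply: val_inj.
Qed.

Lemma linmap_eq (R : realType) (r : nat) (u v : 'M[R]_r) :
  (forall j, (1 <= j <= r)%N -> u *m e R r j = v *m e R r j) -> u = v.
Proof.
move=> uv; have cole (w : 'M[R]_r) (i j : 'I_r) :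
  w i j = (w *m e R r j.+1) i 0.
  rewrite !mxE (bigD1 j) //= !mxE eqxx mulr1 big1 ?addr0 // => k nkj.
  rewrite !mxE eqSS; case: eqP => [kj|]; last by rewrite mulr0.
  by case/eqP: nkj; apply: val_inj.
by apply/matrixP => i j; rewrite !cole uv /= ?ltn_ord.
Qed.

Lemma cycle_uniq (r : nat) (s : seq nat) :
  increasing_subset r s -> uniq (rcons s r).
Proof.
case/andP=> ss /allP rs; rewrite rcons_uniq (sorted_uniq ltn_trans ltnn) // andbT.
by apply/negP => /rs; rewrite ltnn andbF.
Qed.

Lemma p_I_r (r : nat) (s : seq nat) :
  s != [::] -> increasing_subset r s -> p_I r s r = head 0%N s.
Proof.
move=> s0 /cycle_uniq us; rewrite /p_I -(next_rotr 1 us) rotr1_rcons.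
by case: s s0 {us} => //= x s _; rewrite eqxx.
Qed.

Lemma p_I_last (r : nat) (s : seq nat) :
  s != [::] -> increasing_subset r s -> p_I r s (last 0%N s) = r.
Proof.
move=> s0 /cycle_uniq us; rewrite /p_I -(next_rotr 1 us) rotr1_rcons.
case/lastP: s s0 us => // s k _ us; rewrite last_rcons.
have us' : uniq (r :: rcons s k) by rewrite -(rotr1_rcons) rotr_uniq.
by rewrite -(next_rotr 1 us') -rcons_cons rotr1_rcons /= eqxx.
Qed.

Lemma p_I_range (r : nat) (s : seq nat) (j : nat) :
  increasing_subset r s -> (1 <= j <= r)%N -> (1 <= p_I r s j <= r)%N.
Proof.
move=> Is jr; rewrite /p_I.
have [js|js] := boolP (j \in rcons s r); last first.
  by rewrite next_nth (negPf js).
have r1 : (1 <= r)%N by case/andP: jr => /leq_trans; apply.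
move: js; rewrite -mem_next mem_rcons inE => /predU1P[->|]; first by rewrite r1 /=.
by case/andP: Is => _ /allP /[apply] /andP[-> /ltnW].
Qed.

Lemma p_I_inj (r : nat) (s : seq nat) :
  increasing_subset r s -> injective (p_I r s).
Proof. by move=> /cycle_uniq us; apply: can_inj (prev_next us). Qed.

Lemma p_I_perm (r : nat) (s : seq nat) : increasing_subset r s ->
  exists sg : 'S_r, forall j : 'I_r, (sg j).+1 = p_I r s j.+1.
Proof.
move=> Is; pose f (j : 'I_r) : 'I_r := insubd j (p_I r s j.+1).-1.
have fE j : (f j).+1 = p_I r s j.+1.
  have /andP[p1 pr] : (1 <= p_I r s j.+1 <= r)%N by apply: p_I_range; rewrite //= ltn_ord.
  by rewrite /f val_insubd prednK // pr prednK.
have finj : injective f.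
  by move=> i j ij; apply: val_inj; have := fE i; rewrite ij fE => /(p_I_inj Is) [].
by exists (perm finj) => j; rewrite permE.
Qed.

Lemma card_all_but_one (r k : nat) : odd r -> (1 <= k <= r)%N ->
  ~~ odd #|[set j : 'I_r | (j : nat).+1 != k]%SET|.
Proof.
case: k => [|k] //= oddr kr.
have -> : [set j : 'I_r | (j : nat).+1 != k.+1]%SET = [set~ Ordinal kr]%SET.
  by apply/finset.setP => j; rewrite !inE eqSS.
by rewrite cardsC1 card_ord; case: r oddr kr => //=.
Qed.

Lemma last_range (r : nat) (s : seq nat) :
  s != [::] -> increasing_subset r s -> (1 <= last 0%N s < r)%N.
Proof.
case: s => // x s _ /andP[_ /allP rs].
exact: rs (mem_last x s).
Qed.

Lemma c_I_WD (R : realType) (r : nat) (s : seq nat) :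
  odd r -> s != [::] -> increasing_subset r s -> WD R r (c_I R r s).
Proof.
move=> oddr s0 Is; have [sg sgE] := p_I_perm Is.
exists sg, [set j : 'I_r | (j : nat).+1 != r]%SET; split.
  by apply: card_all_but_one; rewrite // leqnn andbT odd_gt0.
move=> j; rewrite linmapE /= ?ltn_ord // inE sgE; case: eqP => [->|_] /=.
  by rewrite p_I_r // expr0 scale1r.
by rewrite expr1 scaleN1r.
Qed.

Lemma d_I_WD (R : realType) (r : nat) (s : seq nat) :
  odd r -> s != [::] -> increasing_subset r s -> WD R r (d_I R r s).
Proof.
move=> oddr s0 Is; have [sg sgE] := p_I_perm Is.
have /andP[k1 kr] := last_range s0 Is.
exists sg, [set j : 'I_r | (j : nat).+1 != last 0%N s]%SET; split.
  by apply: card_all_but_one => //; rewrite k1 ltnW.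
move=> j; rewrite linmapE /= ?ltn_ord // inE sgE; case: eqP => [->|_] /=.
  by rewrite p_I_r // gtn_eqF //= expr1 scaleN1r.
case: eqP => [->|_] /=; first by rewrite p_I_last // expr0 scale1r.
by rewrite expr1 scaleN1r.
Qed.

Lemma tauK (R : realType) (r : nat) : tau R r *m tau R r = 1%:M.
Proof.
apply: linmap_eq => j jr; rewrite mul1mx -mulmxA [tau _ _ *m e _ _ _]linmapE //.
case: eqP => [->|/eqP/negPf nj]; last by rewrite linmapE // nj.
have rr : (1 <= r <= r)%N by rewrite leqnn andbT; case/andP: jr => /leq_trans; apply.
by rewrite mulmxN linmapE // eqxx opprK.
Qed.

Lemma d_I_conj (R : realType) (r : nat) (s : seq nat) :
  s != [::] -> increasing_subset r s ->
  d_I R r s = tau R r *m c_I R r s *m invmx (tau R r).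
Proof.
move=> s0 Is; have [tu _] := mulmx1_unit (tauK R r).
have -> : invmx (tau R r) = tau R r.
  by rewrite -[LHS]mulmx1 -(tauK R r) mulKmx.
apply: linmap_eq => j jr; rewrite -!mulmxA [d_I _ _ _ *m _]linmapE //.
have rr : (1 <= r <= r)%N by rewrite leqnn andbT; case/andP: jr => /leq_trans; apply.
have hr : (head 0%N s == r) = false.
  case/andP: Is => _ /allP; case: (s) s0 => // x t _ /(_ x); rewrite inE eqxx /=.
  by move=> /(_ isT) /andP[_ /ltn_eqF].
have h1 : (1 <= head 0%N s <= r)%N by rewrite -(p_I_r s0 Is); apply: p_I_range.
have [->|/negPf nj] := eqVneq j r.
  rewrite [tau _ _ *m e _ _ _]linmapE // eqxx.
  by rewrite !mulmxN linmapE // eqxx linmapE // hr.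
rewrite [tau _ _ *m e _ _ _]linmapE // nj linmapE // nj mulmxN.
rewrite linmapE ?p_I_range //.
have -> : (p_I r s j == r) = (j == last 0%N s).
  by rewrite -(inj_eq (p_I_inj Is) j) p_I_last.
by case: eqP => // _; rewrite opprK.
Qed.

(* Main.v *)
Require Import Defs.
From HB Require Import structures.
From mathcomp Require Import all_boot all_order fingroup perm all_algebra.
From mathcomp Require Import boolp classical_sets reals.

Set Implicit Arguments.
Unset Strict Implicit.
Unset Printing Implicit Defensive.

Import Order.TTheory GRing.Theory Num.Theory.

Local Open Scope classical_set_scope.
Local Open Scope ring_scope.

(** The proof rests on two devices.

    - The sum of the first [k] coordinates ([psum k]) is nonnegative on every
      simple root, so it is monotone for the root order, and nonnegative on
      every positive root.  These functionals decide everything: they show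
      that [e_a - e_b <= e_c - e_d] forces [c <= a] and [b <= d]
      ([root_le_sub_inv]), while the converse holds because the [e_j] decrease
      with [j] in the root order ([root_le_sub]).

    - A root in [nu_(k+1)(u)] is the source of an arrow of [Gamma_u] into
      [nu_k(u)] ([nuS_arrow]), so the sets [nu_k] can be read off the graph.

    For [c = c_I] only two kinds of positive roots stay positive under [c]
    ([nu0_c_I]).  The root [e_a - e_b] with [b < r] does so exactly when
    [p_I b < p_I a]; as [p_I] moves no index below [r] downwards, this means
    that [a] is in [I] and [b] lies in the gap after [a], and the image is
    [A(a,b)].  The root [e_i + e_r] is sent to [e_(i_1) - e_(p_I i)], one of the
    [B(q)].  So the inverse of [c] sends [A(a,b)] to [e_a - e_b] and [B(q)] to
    some [e_i + e_r].  Comparing these with the vertices: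

    - every vertex has coordinate sum [0] and [e_i + e_r] has [2], hence no
      arrow leaves a [B(q)];
    - an arrow from [A(a,b)] to [A(a',b')] would give
      [b' <= a < b <= n_I a'] with [a' < b'], placing the element [a] of [I]
      strictly between [a'] and its successor;
    - for [A(a,b)] and [B(q)] the order condition is [i_1 <= a] and [b <= q],
      the first half of which is automatic.

    Thus every arrow goes from [A_I] to [B_I], each [A(a,b)] having one to
    [B(r)]; this gives [nu_1 = A_I], and then [nu_2] is empty because no arrow
    ends in [A_I].

    Finally, [tau] exchanges the last two simple roots and fixes the others, so
    it preserves both the positive roots and the root order.  Conjugation by
    [tau] therefore carries the graph and the sets [nu_k] of [c_I] to those of
    [d_I] ([arrow_tauJ], [nu_tauJE]). *)

(** * Invertibility of signed permutations *)

(** The inverse is the transpose: the permutation is undone and every sign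
    squares to [1]. *)
Lemma WD_unitmx (R : realType) (r : nat) (u : 'M[R]_r) :
  WD R r u -> u \in unitmx.
Proof.
case=> [sg [neg [_ ue]]].
pose v : 'M[R]_r := \matrix_(i, j) ((-1) ^+ (i \in neg) * (sg i == j)%:R).
have uE i k : u i k = (-1) ^+ (k \in neg) * (i == sg k)%:R.
  have := congr1 (fun x : 'cV[R]_r => x i 0) (ue k).
  rewrite !mxE eqSS => <-.
  rewrite (bigD1 k) //= !mxE eqxx mulr1 big1 ?addr0 // => l nl.
  by rewrite !mxE eqSS (inj_eq val_inj) (negPf nl) mulr0.
suff uv : u *m v = 1%:M by case: (mulmx1_unit uv).
apply/matrixP => i j; rewrite !mxE (bigD1 (sg^-1 j)%g) //= big1 => [|k nk].
  by rewrite addr0 uE mxE permKV eqxx mulr1 mulrAC -expr2 sqrr_sign mul1r.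
rewrite mxE; case: eqP => [kj|_]; last by rewrite !mulr0.
by rewrite -kj permK eqxx in nk.
Qed.

(** * Partial coordinate sums and the root order *)

(** For [k <= r - 2] and [k = r] these are, up to a positive factor, pairings
    with fundamental coweights; [k = r - 1] pairs with the sum of the last two
    of them. *)
Definition psum (R : realType) (r k : nat) (x : 'cV[R]_r) : R :=
  \sum_(i < r | (i < k)%N) x i 0.

Fact psum_is_zmod_morphism (R : realType) (r k : nat) :
  zmod_morphism (@psum R r k).
Proof.
by move=> x y; rewrite /psum -sumrB; apply: eq_bigr => i _; rewrite !mxE.
Qed.

HB.instance Definition _ (R : realType) (r k : nat) :=
  GRing.isZmodMorphism.Build 'cV[R]_r R (@psum R r k)
    (@psum_is_zmod_morphism R r k).

Lemma psum_e (R : realType) (r k j : nat) :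
  (1 <= j <= r)%N -> psum k (e R r j) = (j <= k)%:R.
Proof.
case: j => [//|j] /= jr; rewrite /psum.
have [jk|kj] := ltnP j k.
  rewrite (bigD1 (Ordinal jr)) //= mxE eqxx big1 ?addr0 // => i /andP[_ ni].
  by rewrite mxE eqSS -[j]/(val (Ordinal jr)) (inj_eq val_inj) (negPf ni).
rewrite big1 // => i ik; rewrite mxE eqSS.
by rewrite ltn_eqF // (leq_trans ik).
Qed.

Lemma psum_sub_ge0 (R : realType) (r k i j : nat) :
  (1 <= i <= r)%N -> (1 <= j <= r)%N -> (i <= j)%N ->
  0 <= psum k (e R r i - e R r j).
Proof.
move=> hi hj ij; rewrite raddfB /= !psum_e // subr_ge0 ler_nat.
by case: (leqP j k) => // jk; rewrite (leq_trans ij jk).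
Qed.

Lemma psum_add_ge0 (R : realType) (r k i j : nat) :
  (1 <= i <= r)%N -> (1 <= j <= r)%N -> 0 <= psum k (e R r i + e R r j).
Proof. by move=> hi hj; rewrite raddfD /= !psum_e // addr_ge0. Qed.

Lemma psum_pos_root (R : realType) (r k : nat) (x : 'cV[R]_r) :
  pos_roots R r x -> 0 <= psum k x.
Proof.
case=> i [j [i1 ij jr xE]].
have hi : (1 <= i <= r)%N by rewrite i1 (leq_trans (ltnW ij)).
have hj : (1 <= j <= r)%N by rewrite jr (leq_trans i1 (ltnW ij)).
case: xE => ->; first by apply: psum_sub_ge0 => //; apply: ltnW.
exact: psum_add_ge0.
Qed.

Lemma psum_root_le (R : realType) (r k : nat) (x y : 'cV[R]_r) :
  (2 <= r)%N -> root_le x y -> psum k x <= psum k y.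
Proof.
move=> r2 [m xy]; rewrite -subr_ge0 -raddfB xy raddf_sum big_nat.
apply: sumr_ge0 => a /andP[a1 ar]; rewrite raddfMn mulrn_wge0 //.
rewrite /simple_root; case: ifP => h.
  by apply: psum_sub_ge0; rewrite ?a1 ?(ltnW h).
by case: r r2 {xy ar h x y} => [//|[//|r]] _; apply: psum_add_ge0; rewrite /= ?leqnn ?leqnSn.
Qed.

Lemma pos_root_sub_ltn (R : realType) (r i j : nat) :
  (1 <= i <= r)%N -> (1 <= j <= r)%N -> i != j ->
  pos_roots R r (e R r i - e R r j) -> (i < j)%N.
Proof.
move=> hi hj nij /(psum_pos_root j); rewrite raddfB /= !psum_e // leqnn.
by rewrite subr_ge0 ler_nat [(i < j)%N]ltn_neqAle nij; case: (i <= j)%N.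
Qed.

(** The sum of all the coordinates is [-2]. *)
Lemma neg_root_sum (R : realType) (r i j : nat) :
  (1 <= i <= r)%N -> (1 <= j <= r)%N ->
  ~ pos_roots R r (- e R r i - e R r j).
Proof.
move=> hi hj /(psum_pos_root r); rewrite raddfB raddfN /= !psum_e //.
case/andP: hi => _ ->; case/andP: hj => _ ->.
by rewrite -opprD oppr_ge0 -natrD lern0.
Qed.

(** The partial sums of lengths [a] and [b - 1] equal [1] on the smaller root,
    hence also on the larger one, whose partial sums can be [1] only from [c]
    to [d - 1]. *)
Lemma root_le_sub_inv (R : realType) (r a b c d : nat) :
  (2 <= r)%N -> (1 <= a <= r)%N -> (1 <= b <= r)%N -> (1 <= c <= r)%N ->
  (1 <= d <= r)%N -> (a < b)%N ->
  root_le (e R r a - e R r b) (e R r c - e R r d) -> (c <= a)%N /\ (b <= d)%N.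
Proof.
move=> r2 ha hb hc hd ab le.
have le1_subb (P Q : bool) : 1 <= P%:R - Q%:R :> R -> P && ~~ Q.
  by rewrite lerBrDr -(natrD _ 1) ler_nat; case: P Q => [] [].
split.
  have := psum_root_le a r2 le; rewrite !raddfB /= !psum_e // leqnn leqNgt ab subr0.
  by move/le1_subb/andP => [].
have b1 : (1 <= b)%N by case/andP: hb.
have := psum_root_le b.-1 r2 le; rewrite !raddfB /= !psum_e //.
rewrite -ltnS prednK // ab -[X in _ - X%:R <= _]/(nat_of_bool (b <= b.-1)%N).
rewrite (leqNgt b) prednK // leqnn subr0 => /le1_subb/andP[_].
by rewrite -ltnNge prednK.
Qed.

Lemma root_le_refl (R : realType) (r : nat) (x : 'cV[R]_r) : root_le x x.
Proof. by exists (fun=> 0%N); rewrite subrr big1. Qed.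

Lemma root_leD (R : realType) (r : nat) (x y x' y' : 'cV[R]_r) :
  root_le x y -> root_le x' y' -> root_le (x + x') (y + y').
Proof.
move=> [m xy] [m' xy']; exists (fun a => m a + m' a)%N.
rewrite opprD addrACA xy xy' -big_split.
by apply: eq_bigr => a _; rewrite mulrnDr.
Qed.

Lemma root_leN (R : realType) (r : nat) (x y : 'cV[R]_r) :
  root_le x y -> root_le (- y) (- x).
Proof. by move=> [m xy]; exists m; rewrite opprK addrC. Qed.

Lemma root_le_trans (R : realType) (r : nat) (x y z : 'cV[R]_r) :
  root_le x y -> root_le y z -> root_le x z.
Proof.
move=> /root_leD h /h [m yz]; exists m.
by rewrite -yz [x + y]addrC opprD addrACA subrr add0r.
Qed.

(** Consecutive basis vectors differ by a simple root. *)
Lemma root_le_e (R : realType) (r c a : nat) :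
  (1 <= c)%N -> (c <= a <= r)%N -> root_le (e R r a) (e R r c).
Proof.
move=> c1 /andP[ca]; elim: a ca => [|a IH]; first by case: c c1.
rewrite leq_eqVlt => /predU1P[<- _|ca ar]; first exact: root_le_refl.
apply: root_le_trans (IH ca (ltnW ar)).
have ai : a \in index_iota 1 r.+1.
  by rewrite mem_index_iota (leq_trans c1 ca) ltnS ltnW.
exists (fun i => (i == a)%N : nat).
rewrite (bigD1_seq a) ?iota_uniq //= eqxx /simple_root ar big1 ?addr0 // => i.
by move=> /negPf->.
Qed.

Lemma root_le_sub (R : realType) (r a b c d : nat) :
  (1 <= c)%N -> (c <= a <= r)%N -> (1 <= b)%N -> (b <= d <= r)%N ->
  root_le (e R r a - e R r b) (e R r c - e R r d).
Proof.
by move=> *; apply: root_leD; [apply: root_le_e|apply/root_leN/root_le_e].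
Qed.

(** * The sets nu_k in terms of the arrows *)

Lemma nu_sub0 (R : realType) (r k : nat) (u : 'M[R]_r) : nu u k `<=` nu u 0.
Proof. by case: k => [//|k] x [[y [py _] <-] px]; split=> //; exists y. Qed.

(** Writing [x = u g], the condition [g <= y] is the arrow condition from [x]
    to [y]; the requirement that [g] be positive is the first half of [x] being
    a vertex. *)
Lemma nuS_arrow (R : realType) (r k : nat) (u : 'M[R]_r) (x : 'cV[R]_r) :
  u \in unitmx ->
  nu u k.+1 x <-> exists2 y, nu u k y & arrow (Gamma u) x y.
Proof.
move=> uu; split.
  case=> [[g [pg [y ny gy]] <-] px]; exists y => //.
  split; [by split=> //; exists g|exact: nu_sub0 ny|by rewrite mulKmx].
case=> y ny [[[g pg <-] px] _]; rewrite mulKmx // => gy.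
by split=> //; exists g => //; split=> //; exists y.
Qed.

(** * The cycle p_I *)

(** Splitting the increasing sequence at [a], both sides are the head of what
    follows [a], with [r] as the default. *)
Lemma n_I_p_I (r : nat) (s : seq nat) (a : nat) :
  increasing_subset r s -> a \in s -> p_I r s a = n_I r s a.
Proof.
move=> Is; have := cycle_uniq Is; have /andP[] := Is.
rewrite sorted_pairwise; last exact: ltn_trans.
move=> ss _ us as_; case/splitPr: as_ ss us => s1 s2.
rewrite pairwise_cat /= => /and4P[/allrelP s12 _ s2a _].
rewrite /n_I filter_cat /= ltnn rcons_cat /= => us.
have -> : [seq x <- s1 | (a < x)%N] = [::].
  apply/eqP; rewrite -[_ == _]negbK -has_filter; apply/hasPn => x xs1.
  by rewrite -leqNgt; apply: ltnW; apply: (s12 x a xs1 (mem_head a s2)).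
have -> : [seq x <- s2 | (a < x)%N] = s2 by apply/all_filterP.
rewrite /p_I rcons_cat /= -(next_rot (size s1) us) rot_size_cat /=.
case: s2 {s12 s2a us} => [|x s2] /=; last by rewrite eqxx.
by rewrite eqxx.
Qed.

Lemma p_I_notin (r : nat) (s : seq nat) (b : nat) :
  b \notin s -> b != r -> p_I r s b = b.
Proof.
by move=> bs br; rewrite /p_I next_nth mem_rcons inE (negPf br) (negPf bs).
Qed.

Lemma n_I_gt (r : nat) (s : seq nat) (a : nat) : (a < r)%N -> (a < n_I r s a)%N.
Proof.
move=> ar; rewrite /n_I; have := filter_all (fun x => (a < x)%N) s.
by case: [seq _ <- _ | _] => [|x t] //= /andP[].
Qed.

Lemma n_I_le_r (r : nat) (s : seq nat) (a : nat) :
  increasing_subset r s -> (n_I r s a <= r)%N.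
Proof.
case/andP=> _ /allP rs; rewrite /n_I.
case E: [seq _ <- _ | _] => [|x t] //=.
have : x \in [seq x <- s | (a < x)%N] by rewrite E mem_head.
by rewrite mem_filter => /andP[_ /rs/andP[_ /ltnW]].
Qed.

Lemma n_I_min (r : nat) (s : seq nat) (a x : nat) :
  increasing_subset r s -> x \in s -> (a < x)%N -> (n_I r s a <= x)%N.
Proof.
case/andP=> ss _ xs ax; rewrite /n_I.
have : x \in [seq x <- s | (a < x)%N] by rewrite mem_filter ax.
have := sorted_filter ltn_trans (fun x => (a < x)%N) ss.
case: [seq _ <- _ | _] => [|y t] //= /(order_path_min ltn_trans)/allP yt.
by rewrite inE => /predU1P[->|/yt/ltnW].
Qed.

Lemma head_range (r : nat) (s : seq nat) :
  s != [::] -> increasing_subset r s -> (1 <= head 0%N s < r)%N.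
Proof.
case: s => // x s _ /andP[_ /allP rs]; exact: rs (mem_head x s).
Qed.

Lemma head_le (r : nat) (s : seq nat) (a : nat) :
  increasing_subset r s -> a \in s -> (head 0%N s <= a)%N.
Proof.
case/andP; case: s => [//|x s] /= /(order_path_min ltn_trans)/allP xs _.
by rewrite inE => /predU1P[->|/xs/ltnW].
Qed.

(** The cycle goes up along [I] and drops only at [r]. *)
Lemma p_I_ge (r : nat) (s : seq nat) (j : nat) :
  increasing_subset r s -> (j < r)%N -> (j <= p_I r s j)%N.
Proof.
move=> Is jr; have [js|js] := boolP (j \in s).
  by rewrite n_I_p_I // ltnW // n_I_gt.
by rewrite p_I_notin // ltn_eqF.
Qed.

(** The gap between [a] and its successor contains no element of [I]; this is
    why [p_I] fixes the index [b] of a root [A(a,b)]. *)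
Lemma rangeA_bounds (r : nat) (s : seq nat) (a b : nat) :
  increasing_subset r s -> rangeA r s a b ->
  [/\ (1 <= a)%N, (a < b)%N, (b < n_I r s a)%N, (n_I r s a <= r)%N & b \notin s].
Proof.
move=> Is /and3P[as_ ab bn]; have nr := n_I_le_r a Is.
have /andP[_ /allP/(_ a as_)/andP[a1 _]] := Is.
split=> //; apply/negP => bs; have := n_I_min Is bs ab.
by rewrite leqNgt bn.
Qed.

(** * The vertices of the graph of c_I *)

Lemma c_I_e (R : realType) (r : nat) (s : seq nat) (j : nat) :
  (1 <= j < r)%N -> c_I R r s *m e R r j = - e R r (p_I r s j).
Proof.
move=> /andP[j1 jr]; have jr' : (1 <= j <= r)%N by rewrite j1 ltnW.
by rewrite (linmapE _ jr') (ltn_eqF jr).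
Qed.

Lemma c_I_er (R : realType) (r : nat) (s : seq nat) :
  (1 <= r)%N -> c_I R r s *m e R r r = e R r (head 0%N s).
Proof.
move=> r1; have rr : (1 <= r <= r)%N by rewrite r1 leqnn.
by rewrite (linmapE _ rr) eqxx.
Qed.

Lemma c_I_rootA (R : realType) (r : nat) (s : seq nat) (a b : nat) :
  increasing_subset r s -> rangeA r s a b ->
  c_I R r s *m (e R r a - e R r b) = rootA R r s a b.
Proof.
move=> Is h; have [a1 ab bn nr bs] := rangeA_bounds Is h.
have br := leq_trans bn nr; have as_ : a \in s by case/andP: h.
rewrite mulmxBr !c_I_e ?a1 ?(ltn_trans ab br) ?(leq_trans a1 (ltnW ab)) //.
by rewrite n_I_p_I // p_I_notin ?ltn_eqF // opprK addrC.
Qed.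

(** The index [i] is the preimage of [q] under the cycle; it is not [r], since
    [r] is the preimage of [i_1] and [i_1 < q]. *)
Lemma c_I_rootB (R : realType) (r : nat) (s : seq nat) (q : nat) :
  s != [::] -> increasing_subset r s -> rangeB r s q ->
  exists2 i, (1 <= i < r)%N & c_I R r s *m (e R r i + e R r r) = rootB R r s q.
Proof.
move=> s0 Is /andP[hq qr]; have /andP[h1 hr] := head_range s0 Is.
have q0 : (0 < q)%N by apply: leq_ltn_trans hq.
have [sg sgE] := p_I_perm Is.
have q1r : (q.-1 < r)%N by rewrite prednK.
pose i : 'I_r := (sg^-1 (Ordinal q1r))%g.
have pi : p_I r s i.+1 = q by rewrite -sgE permKV /= prednK.
have ir : (i.+1 < r)%N.
  rewrite ltn_neqAle ltn_ord andbT; apply/eqP => ir.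
  by move: hq; rewrite -pi ir p_I_r // ltnn.
exists i.+1; rewrite ?ir // mulmxDr c_I_e ?ir // c_I_er ?(leq_trans _ (ltnW ir)) //.
by rewrite pi addrC.
Qed.

Lemma nu0_rootA (R : realType) (r : nat) (s : seq nat) (a b : nat) :
  increasing_subset r s -> rangeA r s a b -> nu (c_I R r s) 0 (rootA R r s a b).
Proof.
move=> Is h; have [a1 ab bn nr _] := rangeA_bounds Is h.
split; last by exists b, (n_I r s a); split; rewrite ?(leq_trans a1 (ltnW ab)) //; left.
exists (e R r a - e R r b); last exact: c_I_rootA.
by exists a, b; split; rewrite // ?(leq_trans (ltnW bn)) //; left.
Qed.

Lemma nu0_rootB (R : realType) (r : nat) (s : seq nat) (q : nat) :
  s != [::] -> increasing_subset r s -> rangeB r s q ->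
  nu (c_I R r s) 0 (rootB R r s q).
Proof.
move=> s0 Is h; have /andP[h1 hr] := head_range s0 Is; have /andP[hq qr] := h.
split; last by exists (head 0%N s), q; split=> //; left.
have [i /andP[i1 ir] <-] := c_I_rootB R s0 Is h.
exists (e R r i + e R r r) => //.
by exists i, r; split=> //; right.
Qed.

(** Of the four types of images, [c(e_i - e_r)] and [c(e_i + e_j)] with [j < r]
    have both signs negative and are never positive roots.  The root
    [c(e_i + e_r)] yields a [B(q)].  If [c(e_i - e_j)] is positive for [j < r],
    then [i < j <= p_I j < p_I i], so [p_I] moves [i]: hence [i] is in [I], and
    [j] lies in the gap after [i]. *)
Lemma nu0_c_I (R : realType) (r : nat) (s : seq nat) (x : 'cV[R]_r) :
  s != [::] -> increasing_subset r s -> nu (c_I R r s) 0 x ->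
  A_I R r s x \/ exists2 q, rangeB r s q & x = rootB R r s q.
Proof.
move=> s0 Is [[g [i [j [i1 ij jr gE]]] <-]].
have ir : (i < r)%N by apply: leq_trans jr.
have j1 : (1 <= j)%N by apply: leq_trans (ltnW ij).
have r1 : (1 <= r)%N by apply: leq_trans jr.
have pi : (1 <= p_I r s i <= r)%N by rewrite p_I_range // i1 ltnW.
have pj : (1 <= p_I r s j <= r)%N by rewrite p_I_range // j1.
have pij : p_I r s i != p_I r s j by rewrite (inj_eq (p_I_inj Is)) ltn_eqF.
have hh : (1 <= head 0%N s <= r)%N by rewrite -(p_I_r s0 Is) p_I_range // r1 /=.
have ci : c_I R r s *m e R r i = - e R r (p_I r s i) by rewrite c_I_e ?i1.
move: jr; rewrite leq_eqVlt => /predU1P[jr|jr].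
  have cj : c_I R r s *m e R r j = e R r (head 0%N s) by rewrite jr c_I_er.
  case: gE => ->; rewrite ?mulmxBr ?mulmxDr ci cj => px.
    by case: (neg_root_sum pi hh px).
  move: px pij; rewrite addrC jr p_I_r // eq_sym => px pij.
  have hp := pos_root_sub_ltn hh pi pij px.
  right; exists (p_I r s i) => //; rewrite /rangeB hp.
  by case/andP: pi.
have cj : c_I R r s *m e R r j = - e R r (p_I r s j) by rewrite c_I_e ?j1.
case: gE => ->; rewrite ?mulmxBr ?mulmxDr ci cj => px; last first.
  by case: (neg_root_sum pi pj px).
move: px pij; rewrite opprK addrC eq_sym => px pij.
have pji := pos_root_sub_ltn pj pi pij px.
have jpi : (j < p_I r s i)%N := leq_ltn_trans (p_I_ge Is jr) pji.
have is_ : i \in s.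
  apply: contraLR jpi => /p_I_notin -> //; last by rewrite ltn_eqF.
  by rewrite -leqNgt ltnW.
have nE := n_I_p_I Is is_; rewrite nE in jpi.
have rA : rangeA r s i j by rewrite /rangeA is_ ij.
left; exists i, j; split=> //.
have [_ _ _ _ js] := rangeA_bounds Is rA.
by rewrite /rootA nE p_I_notin // ltn_eqF.
Qed.

(** * The arrows and the sets nu_k for c_I *)

Lemma arrow_rootA (R : realType) (r : nat) (s : seq nat) (a b : nat)
    (y : 'cV[R]_r) :
  odd r -> s != [::] -> increasing_subset r s -> rangeA r s a b ->
  arrow (Gamma (c_I R r s)) (rootA R r s a b) y <->
  nu (c_I R r s) 0 y /\ root_le (e R r a - e R r b) y.
Proof.
move=> ro s0 Is h; have cu := WD_unitmx (c_I_WD R ro s0 Is).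
have nA := nu0_rootA R Is h.
have cA : invmx (c_I R r s) *m rootA R r s a b = e R r a - e R r b.
  by rewrite -(c_I_rootA R Is h) mulKmx.
by split=> [[_ ny]|[ny le]]; [rewrite cA|split; rewrite ?cA].
Qed.

Lemma arrow_AB (R : realType) (r : nat) (s : seq nat) (a b q : nat) :
  (2 <= r)%N -> odd r -> s != [::] -> increasing_subset r s ->
  rangeA r s a b -> rangeB r s q ->
  arrow (Gamma (c_I R r s)) (rootA R r s a b) (rootB R r s q) <-> (b <= q)%N.
Proof.
move=> r2 ro s0 Is hA hB; rewrite arrow_rootA //.
have [a1 ab bn nr _] := rangeA_bounds Is hA.
have br := leq_trans (ltnW bn) nr; have ar := leq_trans (ltnW ab) br.
have b1 := leq_trans a1 (ltnW ab).
have /andP[h1 hr] := head_range s0 Is; have /andP[hq qr] := hB.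
have as_ : a \in s by case/andP: hA.
split=> [[_]|bq].
  by case/root_le_sub_inv; rewrite ?a1 ?b1 ?h1 ?(ltnW hr) ?(leq_ltn_trans _ hq).
split; first exact: nu0_rootB.
by apply: root_le_sub; rewrite ?(head_le Is) ?bq.
Qed.

(** The order condition would make [a] an element of [I] strictly between [a']
    and its successor in [I]. *)
Lemma no_arrow_to_A (R : realType) (r : nat) (s : seq nat) (a b a' b' : nat) :
  (2 <= r)%N -> odd r -> s != [::] -> increasing_subset r s ->
  rangeA r s a b -> rangeA r s a' b' ->
  ~ arrow (Gamma (c_I R r s)) (rootA R r s a b) (rootA R r s a' b').
Proof.
move=> r2 ro s0 Is h h'; rewrite arrow_rootA // => -[_].
have [a1 ab bn nr _] := rangeA_bounds Is h.
have [a1' ab' bn' nr' _] := rangeA_bounds Is h'.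
have br := leq_trans (ltnW bn) nr; have ar := leq_trans (ltnW ab) br.
have br' := leq_trans (ltnW bn') nr'; have b1' := leq_trans a1' (ltnW ab').
have as_ : a \in s by case/andP: h.
case/root_le_sub_inv; rewrite ?a1 ?ar ?br ?b1' ?br' ?nr' ?(leq_trans a1 (ltnW ab)) //.
  by rewrite (leq_trans b1' (ltnW bn')).
move=> ba bn2; have := n_I_min Is as_ (leq_trans ab' ba).
by rewrite leqNgt (leq_trans ab bn2).
Qed.

(** The coordinate sum is [2] on the preimage [e_i + e_r] of [B(q)], but [0] on
    every vertex. *)
Lemma no_arrow_from_B (R : realType) (r : nat) (s : seq nat) (q : nat)
    (y : 'cV[R]_r) :
  (2 <= r)%N -> odd r -> s != [::] -> increasing_subset r s -> rangeB r s q ->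
  ~ arrow (Gamma (c_I R r s)) (rootB R r s q) y.
Proof.
move=> r2 ro s0 Is h [_ ny]; have cu := WD_unitmx (c_I_WD R ro s0 Is).
have [i /andP[i1 ir] <-] := c_I_rootB R s0 Is h; rewrite mulKmx //.
move/(psum_root_le r r2); apply/negP; rewrite -ltNge.
have r1 : (1 <= r)%N by apply: ltnW.
have hh : (1 <= head 0%N s <= r)%N by have /andP[-> /ltnW] := head_range s0 Is.
suff -> : psum r y = 0.
  by rewrite raddfD /= !psum_e ?i1 ?r1 ?leqnn ?(ltnW ir) // -natrD ltr0n.
have psumB0 j k : (1 <= j <= r)%N -> (1 <= k <= r)%N ->
    psum r (e R r j - e R r k) = 0.
  by move=> hj hk; rewrite raddfB /= !psum_e //; case/andP: hj => _ ->; case/andP: hk => _ ->; rewrite subrr.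
case: (nu0_c_I s0 Is ny) => [[a [b [/(rangeA_bounds Is)[a1 ab bn nr _] ->]]]|].
  have b1 := leq_trans a1 (ltnW ab).
  by apply: psumB0; rewrite ?b1 ?nr ?(leq_trans b1 (ltnW bn)) ?(leq_trans (ltnW bn)).
by case=> q' /andP[hq' qr'] ->; apply: psumB0; rewrite ?qr' ?(leq_ltn_trans _ hq').
Qed.

Lemma arrow_c_I (R : realType) (r : nat) (s : seq nat) (x y : 'cV[R]_r) :
  (2 <= r)%N -> odd r -> s != [::] -> increasing_subset r s ->
  arrow (Gamma (c_I R r s)) x y ->
  exists a b q : nat, [/\ rangeA r s a b, rangeB r s q, (b <= q)%N,
    x = rootA R r s a b & y = rootB R r s q].
Proof.
move=> r2 ro s0 Is xy; have [nx ny _] := xy.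
case: (nu0_c_I s0 Is nx) => [[a [b [hA xE]]]|[q hB xE]]; rewrite xE in xy; last first.
  by case: (no_arrow_from_B r2 ro s0 Is hB xy).
case: (nu0_c_I s0 Is ny) => [[a' [b' [hA' yE]]]|[q hB yE]]; rewrite yE in xy.
  by case: (no_arrow_to_A r2 ro s0 Is hA hA' xy).
by exists a, b, q; split=> //; apply/(arrow_AB R r2 ro s0 Is hA hB).
Qed.

(** Every [A(a,b)] has an arrow to [B(r)], as [b <= r]. *)
Lemma nu1_c_I (R : realType) (r : nat) (s : seq nat) :
  (2 <= r)%N -> odd r -> s != [::] -> increasing_subset r s ->
  nu (c_I R r s) 1 = A_I R r s.
Proof.
move=> r2 ro s0 Is; have cu := WD_unitmx (c_I_WD R ro s0 Is).
apply/seteqP; split=> [x /(nuS_arrow _ _ cu)[y _ xy]|x [a [b [hA ->]]]].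
  by have [a [b [q [hA _ _ xE _]]]] := arrow_c_I r2 ro s0 Is xy; exists a, b.
have hB : rangeB r s r by rewrite /rangeB leqnn andbT; case/andP: (head_range s0 Is).
apply/(nuS_arrow _ _ cu); exists (rootB R r s r); first exact: nu0_rootB.
apply/(arrow_AB R r2 ro s0 Is hA hB).
by have [_ _ bn nr _] := rangeA_bounds Is hA; apply: leq_trans nr; apply: ltnW.
Qed.

(** Since [nu_1] consists of roots [A(a,b)], where no arrow ends, [nu_2] is
    empty, and emptiness propagates to all later sets. *)
Lemma nu_c_I_eq0 (R : realType) (r : nat) (s : seq nat) (m : nat) :
  (2 <= r)%N -> odd r -> s != [::] -> increasing_subset r s ->
  (2 <= m)%N -> nu (c_I R r s) m = set0.
Proof.
move=> r2 ro s0 Is; have cu := WD_unitmx (c_I_WD R ro s0 Is).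
case: m => [//|[//|m]] _; elim: m => [|m IH]; apply/seteqP; split=> // x.
  move/(nuS_arrow _ _ cu) => [y]; rewrite nu1_c_I // => -[a [b [hA ->]]] xy.
  have [a' [b' [_ [hA' _ _ xE _]]]] := arrow_c_I r2 ro s0 Is xy.
  by rewrite xE in xy; case: (no_arrow_to_A r2 ro s0 Is hA' hA xy).
by move/(nuS_arrow _ _ cu) => [y]; rewrite IH.
Qed.

(** * Transport by the diagram automorphism tau *)

Lemma tau_e (R : realType) (r j : nat) :
  (1 <= j < r)%N -> tau R r *m e R r j = e R r j.
Proof.
move=> /andP[j1 jr]; have jr' : (1 <= j <= r)%N by rewrite j1 ltnW.
by rewrite (linmapE _ jr') (ltn_eqF jr).
Qed.

Lemma tau_er (R : realType) (r : nat) :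
  (1 <= r)%N -> tau R r *m e R r r = - e R r r.
Proof.
move=> r1; have rr : (1 <= r <= r)%N by rewrite r1 leqnn.
by rewrite (linmapE _ rr) eqxx.
Qed.

(** [tau] fixes [e_i - e_j] and [e_i + e_j] for [j < r], and swaps them for
    [j = r]. *)
Lemma tau_pos_roots (R : realType) (r : nat) (x : 'cV[R]_r) :
  pos_roots R r x -> pos_roots R r (tau R r *m x).
Proof.
case=> i [j [i1 ij jr xE]].
have ti : tau R r *m e R r i = e R r i by rewrite tau_e // i1 (leq_trans ij).
have r1 : (1 <= r)%N by rewrite (leq_trans i1) // (leq_trans (ltnW ij)).
exists i, j; split=> //; move: jr; rewrite leq_eqVlt => /predU1P[jr|jr].
  by case: xE => ->; rewrite ?mulmxBr ?mulmxDr ti jr tau_er ?opprK //; [right|left].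
case: xE => ->; rewrite ?mulmxBr ?mulmxDr ti tau_e ?jr ?andbT; try by [left|right];
by rewrite (leq_trans i1 (ltnW ij)).
Qed.

(** [tau] permutes the simple roots by exchanging the last two, so the
    coefficients of a nonnegative combination are permuted accordingly. *)
Lemma tau_root_le (R : realType) (r : nat) (x y : 'cV[R]_r) :
  (2 <= r)%N -> root_le x y -> root_le (tau R r *m x) (tau R r *m y).
Proof.
case: r x y => [//|[//|r]] x y _ [m xy].
have tauMn (z : 'cV[R]_r.+2) n : tau R r.+2 *m (z *+ n) = (tau R r.+2 *m z) *+ n :> 'cV[R]_r.+2.
  exact: (raddfMn (mulmx (tau R r.+2))).
exists (fun a => if a == r.+2 then m r.+1 else if a == r.+1 then m r.+2 else m a).
rewrite -mulmxBr xy mulmx_sumr !(big_nat_recr r.+2) ?(big_nat_recr r.+1) //=.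
rewrite !eqxx (ltn_eqF (ltnSn _)) -!addrA; congr (_ + _).
  rewrite !big_nat; apply: eq_bigr => a /andP[a1 ar].
  have ar2 : (a < r.+2)%N by apply: ltnW.
  rewrite (ltn_eqF ar) (ltn_eqF ar2) tauMn; congr (_ *+ _).
  by rewrite /simple_root ar2 mulmxBr !tau_e ?a1.
rewrite !tauMn /simple_root ltnSn ltnn /= mulmxBr mulmxDr tau_er // tau_e ?ltnSn //.
by rewrite opprK addrC.
Qed.

Lemma invmx_tau (R : realType) (r : nat) : invmx (tau R r) = tau R r.
Proof.
have [tu _] := mulmx1_unit (tauK R r).
by rewrite -[LHS]mulmx1 -(tauK R r) mulKmx.
Qed.

(** As [tau] is an involution this is conjugation by [tau]. *)
Definition tauJ (R : realType) (r : nat) (u : 'M[R]_r) : 'M[R]_r :=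
  tau R r *m u *m tau R r.

Lemma tau_tau (R : realType) (r n : nat) (x : 'M[R]_(r, n)) :
  tau R r *m (tau R r *m x) = x.
Proof. by rewrite mulmxA tauK mul1mx. Qed.

Lemma tauJK (R : realType) (r : nat) (u : 'M[R]_r) : tauJ (tauJ u) = u.
Proof. by rewrite /tauJ -!mulmxA tau_tau tauK mulmx1. Qed.

Lemma tauJ_unitmx (R : realType) (r : nat) (u : 'M[R]_r) :
  u \in unitmx -> tauJ u \in unitmx.
Proof.
by move=> uu; have [tu _] := mulmx1_unit (tauK R r); rewrite !unitmx_mul tu uu.
Qed.

Lemma nu_tauJ (R : realType) (r k : nat) (u : 'M[R]_r) (x : 'cV[R]_r) :
  (2 <= r)%N -> nu u k x -> nu (tauJ u) k (tau R r *m x).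
Proof.
have tu g : tauJ u *m (tau R r *m g) = tau R r *m (u *m g).
  by rewrite /tauJ -!mulmxA tau_tau.
move=> r2; elim: k x => [|k IH] x.
  case=> [[g pg <-] px]; split; last exact: tau_pos_roots.
  by exists (tau R r *m g) => //; apply: tau_pos_roots.
case=> [[g [pg [y /IH ny gy]] <-] px]; split; last exact: tau_pos_roots.
exists (tau R r *m g) => //; split; first exact: tau_pos_roots.
by exists (tau R r *m y) => //; apply: tau_root_le.
Qed.

(** One inclusion suffices, applied also to [tauJ u], because [tauJ] is an
    involution. *)
Lemma nu_tauJE (R : realType) (r k : nat) (u : 'M[R]_r) :
  (2 <= r)%N -> nu (tauJ u) k = [set tau R r *m x | x in nu u k].
Proof.
move=> r2; apply/seteqP; split=> [x|_ [x nx <-]]; last exact: nu_tauJ.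
by move/(nu_tauJ r2); rewrite tauJK => nx; exists (tau R r *m x); rewrite ?tau_tau.
Qed.

Lemma arrow_tauJ (R : realType) (r : nat) (u : 'M[R]_r) (x y : 'cV[R]_r) :
  (2 <= r)%N -> u \in unitmx ->
  arrow (Gamma u) x y ->
  arrow (Gamma (tauJ u)) (tau R r *m x) (tau R r *m y).
Proof.
move=> r2 uu [nx ny xy]; split; try exact: nu_tauJ.
suff -> : invmx (tauJ u) *m (tau R r *m x) = tau R r *m (invmx u *m x).
  exact: tau_root_le.
apply: (can_inj (mulKmx (tauJ_unitmx uu))); rewrite mulKVmx ?tauJ_unitmx //.
by rewrite /tauJ -!mulmxA tau_tau mulKVmx.
Qed.

Theorem proposition3p5 (R : realType) (r : nat) (s : seq nat)
    (r_ge5 : (5 <= r)%N) (r_odd : odd r)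
    (s_neq0 : s != [::]) (s_sub : increasing_subset r s) :
  [/\ (forall a b q : nat, rangeA r s a b -> rangeB r s q ->
         (arrow (Gamma (c_I R r s)) (rootA R r s a b) (rootB R r s q)
          <-> (b <= q)%N)),
      (forall x y : 'cV[R]_r, arrow (Gamma (c_I R r s)) x y ->
         exists a b q : nat, [/\ rangeA r s a b, rangeB r s q, (b <= q)%N,
           x = rootA R r s a b & y = rootB R r s q]),
      nu (c_I R r s) 1 = A_I R r s &
      (forall m : nat, (2 <= m)%N -> nu (c_I R r s) m = set0)]
  /\
  [/\ (forall a b q : nat, rangeA r s a b -> rangeB r s q ->
         (arrow (Gamma (d_I R r s))
            (tau R r *m rootA R r s a b) (tau R r *m rootB R r s q)
          <-> (b <= q)%N)),
      (forall x y : 'cV[R]_r, arrow (Gamma (d_I R r s)) x y ->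
         exists a b q : nat, [/\ rangeA r s a b, rangeB r s q, (b <= q)%N,
           x = tau R r *m rootA R r s a b & y = tau R r *m rootB R r s q]),
      nu (d_I R r s) 1 = [set tau R r *m x | x in A_I R r s] &
      (forall m : nat, (2 <= m)%N -> nu (d_I R r s) m = set0)].
Proof.
have r2 : (2 <= r)%N by apply: leq_trans r_ge5.
have cu := WD_unitmx (c_I_WD R r_odd s_neq0 s_sub).
have dE : d_I R r s = tauJ (c_I R r s) by rewrite d_I_conj // invmx_tau.
have from_d x y : arrow (Gamma (d_I R r s)) x y ->
    arrow (Gamma (c_I R r s)) (tau R r *m x) (tau R r *m y).
  by rewrite dE => /(arrow_tauJ r2 (tauJ_unitmx cu)); rewrite tauJK.
split; split.
- by move=> a b q hA hB; apply: arrow_AB.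
- by move=> x y; apply: arrow_c_I.
- exact: nu1_c_I.
- by move=> m; apply: nu_c_I_eq0.
- move=> a b q hA hB; rewrite -(arrow_AB R r2 r_odd s_neq0 s_sub hA hB).
  split=> [/from_d|]; first by rewrite !tau_tau.
  by rewrite dE; apply: arrow_tauJ.
- move=> x y /from_d /(arrow_c_I r2 r_odd s_neq0 s_sub).
  case=> a [b [q [hA hB bq xE yE]]]; exists a, b, q.
  by split=> //; rewrite -?xE -?yE tau_tau.
- by rewrite dE nu_tauJE // nu1_c_I.
- by move=> m m2; rewrite dE nu_tauJE // nu_c_I_eq0 // image_set0.
Qed.
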